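(* Let $\tilde k$ be any perfect field of characteristic $p$, let $X$ be a $W(\tilde k)$-scheme and let $\mathrm{Gr}(X)=\varprojlim_n\mathrm{Gr}^{W_n(\tilde k)}(X)$. Then the $\tilde k$-scheme $\mathrm{Gr}(X)$ is isomorphic to the special fiber of the $p$-jet space of infinite level $J^\infty(X)=\varprojlim_n J^n(X)$, or equivalently to the special fiber of $\widehat{J^\infty(X)}=\varprojlim_n\widehat{J^n(X)}$.
   Context: $W_n(B)$ and $W(B)=\varprojlim W_n(B)$ denote $p$-typical Witt vectors, with $W_n(B)=B^{n+1}$ as a set (length $n+1$; note the index shift). $p$-jet space. Let $F$ be the Witt vector Frobenius on $W(\tilde k)$. There is a unique ring morphism $W(\tilde k)\to W(W(\tilde k))$ with ghost components $(\mathrm{id},F,F^2,\dots)$, and for a $W(\tilde k)$-algebra $B$ the ring $W_n(B)$ is a $W(\tilde k)$-algebra via $W(\tilde k)\to W(W(\tilde k))\to W_n(B)$. For a $W(\tilde k)$-scheme $X$, $J^n(X)$ is the functor on $W(\tilde k)$-algebras $J^n(X)(B)=X(W_n(B))$, which is representable by a $W(\tilde k)$-scheme. The transition morphisms $J^{n+1}(X)\to J^n(X)$ are induced by truncation $W_{n+1}(B)\to W_n(B)$. $\widehat{J^n(X)}$ is the $p$-adic formal completion of $J^n(X)$. The special fiber is the base change along $W(\tilde k)\to\tilde k$. Inverse limits are taken as functors of points. Greenberg transform. For a $\tilde k$-scheme $Y$ let $W_n^*(Y)$ be the $W_n(\tilde k)$-scheme obtained by gluing $\mathrm{Spec}\,W_n(B)$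 as $\mathrm{Spec}\,B$ varies among the affine open subschemes of $Y$. For a $W_n(\tilde k)$-scheme $Z$, the Greenberg realization $\mathrm{Gr}^{W_n(\tilde k)}(Z)$ is the $\tilde k$-scheme characterized by $\mathrm{Hom}_{\tilde k}(Y,\mathrm{Gr}^{W_n(\tilde k)}(Z))\simeq\mathrm{Hom}_{W_n(\tilde k)}(W_n^*(Y),Z)$ naturally in $\tilde k$-schemes $Y$; in particular $\mathrm{Gr}^{W_n(\tilde k)}(Z)(B)=Z(W_n(B))$ for $\tilde k$-algebras $B$. For a $W(\tilde k)$-scheme $X$, $\mathrm{Gr}^{W_n(\tilde k)}(X)$ means $\mathrm{Gr}^{W_n(\tilde k)}(X\times_{W(\tilde k)}W_n(\tilde k))$, with transition morphisms induced by truncation. *)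

(* Defs.v *)
From HB Require Import structures.
From mathcomp Require Import all_boot all_order all_algebra.
From mathcomp Require Import finmap.
From mathcomp.multinomials Require Import monalg.
From mathcomp.classical Require Import boolp.

Set Implicit Arguments.
Unset Strict Implicit.
Unset Printing Implicit Defensive.

Import GRing.Theory.
Local Open Scope ring_scope.

(* Rings are commutative with unit and may be zero (comPzRingType), as the     *)
(* functor of points of a scheme is evaluated on all commutative rings.        *)

Section FreeRing.
Variable I : choiceType.
Local Notation freeRing := {malg int[{cmonom I}]}.

Definition freeVar (i : I) : freeRing := << (ucm i : {cmonom I}) >>%R.

Lemma freeRing_ind (K : freeRing -> Prop) :
  K 1 -> (forall f g, K f -> K g -> K (f - g)) ->
  (forall f g, K f -> K g -> K (f * g)) -> (forall i, K (freeVar i)) ->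
  forall f, K f.
Proof.
move=> K1 KB KM KX f.
have K0 : K 0 by rewrite -(subrr 1); apply: KB.
have KN g : K g -> K (- g) by rewrite -sub0r => ?; apply: KB.
have KD g h : K g -> K h -> K (g + h) by move=> ? ?; rewrite -(opprK h); apply/KB/KN.
have KMn g n : K g -> K (g *+ n).
  by move=> Kg; elim: n => [|n IHn]; rewrite ?mulr0n // mulrS; apply: KD.
have KU d (m : {cmonom I}) : mdeg m = d -> K << m >>.
  elim: d m => [|d IHd] m dm.
    by rewrite (mdeg_eq0I dm).
  have [i im] : exists i, i \in finsupp m.
    have [/fsetP m0|[i ?]] := fset_0Vmem (finsupp m); last by exists i.
    by move: dm; rewrite /mdeg big1_seq // => i /=; rewrite m0 in_fset0.
  have Em : m = mmul (ucm i) (divcm m (ucm i)).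
    apply/eqP/cmP => j; rewrite cmM divcmE cmU; case: eqVneq => [<-|_] /=.
      by rewrite subnKC // lt0n cmE_neq0.
    by rewrite add0n subn0.
  have -> : << m >> = freeVar i * << divcm m (ucm i) >>.
    by rewrite /freeVar malgM_def fgmulUU mulr1 -Em.
  apply: KM; first exact: KX.
  apply: IHd; apply/eqP; move/eqP: dm.
  by rewrite {1}Em mdegM mdegU add1n eqSS.
rewrite [f]monalgE.
apply: (big_ind K K0 KD) => m _.
suff -> : << f@_m *g m >> = << m >> *~ f@_m.
  by case: (f@_m) => n; rewrite ?NegzE -?pmulrn ?nmulrn; [|apply: KN]; apply/KMn/KU.
by rewrite -{1}[f@_m]intz raddfMz.
Qed.

Lemma freeRing_ext (B : comPzRingType) (f g : {rmorphism freeRing -> B}) :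
  (forall i, f (freeVar i) = g (freeVar i)) -> f =1 g.
Proof.
move=> fg; apply: freeRing_ind => [|x y|x y|//]; rewrite ?rmorph1 //.
  by rewrite !rmorphB => -> ->.
by rewrite !rmorphM => -> ->.
Qed.

Lemma freeRing_torsion n (f : freeRing) : f *+ n.+1 = 0 -> f = 0.
Proof.
move=> f0; apply/malgP => k; move/malgP/(_ k): f0.
by rewrite mcoeffMn mcoeff0 => /eqP; rewrite Num.Theory.mulrn_eq0 => /eqP.
Qed.

Section Eval.
Variables (B : comNzRingType) (v : I -> B).
Definition monom_eval (m : {cmonom I}) : B := \prod_(i <- finsupp m) v i ^+ m i.

Lemma monom_evalw (m : {cmonom I}) (d : {fset I}) : (finsupp m `<=` d)%fset ->
  monom_eval m = \prod_(i <- d) v i ^+ m i.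
Proof.
move=> md; apply: (big_fset_incl _ md) => i _.
by rewrite -cmE_eq0 => /eqP ->; rewrite expr0.
Qed.

Lemma monom_eval_morph : mmorphism monom_eval.
Proof.
split=> [m1 m2|]; last by rewrite /monom_eval mdom1 big_seq_fset0.
rewrite (@monom_evalw (mmul m1 m2) _ (fsubset_refl _)).
rewrite (@monom_evalw m1 (finsupp (mmul m1 m2))) ?mdomD ?fsubsetUl //.
rewrite (@monom_evalw m2 (finsupp (mmul m1 m2))) ?mdomD ?fsubsetUr //.
by rewrite -big_split; apply: eq_bigr => i _; rewrite cmM exprD.
Qed.
HB.instance Definition _ := isMultiplicative.Build _ _ monom_eval monom_eval_morph.

Definition nz_eval : {rmorphism freeRing -> B} := mmap intr monom_eval.
Lemma nz_evalE i : nz_eval (freeVar i) = v i.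
Proof.
by rewrite /= mmapU mul1r /monom_eval /= mdomU big_seq_fset1 cmUU expr1.
Qed.
End Eval.

Lemma freeRing_eval_ex (B : comPzRingType) (v : I -> B) :
  exists e : {rmorphism freeRing -> B}, forall i, e (freeVar i) = v i.
Proof.
have [B0|B1] := eqVneq (1 : B) 0.
  have B00 (x : B) : x = 0 by rewrite -(mul1r x) B0 mul0r.
  pose e := fun _ : freeRing => 0 : B.
  have eD : nmod_morphism e by split => // x y; rewrite /e addr0.
  have eM : monoid_morphism e by split => // x y; rewrite /e mulr0.
  pose m1 := GRing.isNmodMorphism.Build _ _ e eD.
  pose m2 := GRing.isMonoidMorphism.Build _ _ e eM.
  pose E : {rmorphism freeRing -> B} := HB.pack e m1 m2.
  by exists E => i; rewrite [RHS]B00.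
pose S : comNzRingType := HB.pack (GRing.ComPzRing.sort B)
  (GRing.PzSemiRing_isNonZero.Build B B1).
exists (@nz_eval S v) => i; exact: (@nz_evalE S v i).
Qed.

Definition feval (B : comPzRingType) (v : I -> B) : {rmorphism freeRing -> B} :=
  sval (cid (freeRing_eval_ex v)).
Lemma fevalX (B : comPzRingType) (v : I -> B) i : feval v (freeVar i) = v i.
Proof. exact: (svalP (cid (freeRing_eval_ex v))). Qed.
End FreeRing.

Record polyRing := PolyRing {
  poly_ring :> comPzRingType;
  poly_var : nat -> nat -> poly_ring }.

(* The polynomial ring Z[X_(j,i)]; X_j = (X_(j,i))_i is the generic j-th sequence. *)
HB.lock Definition polyZ : polyRing :=
  @PolyRing {malg int[{cmonom (nat * nat)%type}]}
    (fun j i => freeVar ((j, i) : (nat * nat)%type)).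

Definition polyX : nat -> nat -> polyZ := poly_var polyZ.

Lemma polyZ_ind (K : polyZ -> Prop) :
  K 1 -> (forall f g, K f -> K g -> K (f - g)) ->
  (forall f g, K f -> K g -> K (f * g)) -> (forall j i, K (polyX j i)) ->
  forall f, K f.
Proof.
move: K; rewrite /polyX polyZ.unlock => K K1 KB KM KX.
apply: (@freeRing_ind _ K K1 KB KM) => -[j i]; exact: KX.
Qed.

Lemma polyZ_torsion n (f : polyZ) : (0 < n)%N -> f *+ n = 0 -> f = 0.
Proof. by move: f; rewrite polyZ.unlock; case: n => // n f _; exact: freeRing_torsion. Qed.

Lemma polyZ_ext (B : comPzRingType) (f g : {rmorphism polyZ -> B}) :
  (forall j i, f (polyX j i) = g (polyX j i)) -> f =1 g.
Proof.
move=> fg; apply: polyZ_ind => [|x y|x y|//]; rewrite ?rmorph1 //.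
  by rewrite !rmorphB => -> ->.
by rewrite !rmorphM => -> ->.
Qed.

Lemma peval_ex (B : comPzRingType) (v : nat -> nat -> B) :
  exists e : {rmorphism polyZ -> B}, forall j i, e (polyX j i) = v j i.
Proof.
rewrite /polyX polyZ.unlock /=.
exists (feval (fun ji : nat * nat => v ji.1 ji.2)) => j i.
exact: (fevalX (fun ji : nat * nat => v ji.1 ji.2) (j, i)).
Qed.

Definition peval (B : comPzRingType) (v : nat -> nat -> B) :
  {rmorphism polyZ -> B} := sval (cid (peval_ex v)).

Lemma pevalX (B : comPzRingType) (v : nat -> nat -> B) j i :
  peval v (polyX j i) = v j i.
Proof. exact: (svalP (cid (peval_ex v))). Qed.

Section Congruence.
Variable A : comPzRingType.
Implicit Types (x y z : A) (m n : nat).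

Definition cong m x y := exists z, x = y + z *+ m.

Lemma cong_refl m x : cong m x x.
Proof. by exists 0; rewrite mul0rn addr0. Qed.

Lemma cong_sym m x y : cong m x y -> cong m y x.
Proof. by case=> z ->; exists (- z); rewrite mulNrn addrK. Qed.

Lemma cong_trans m y x z : cong m x y -> cong m y z -> cong m x z.
Proof. by case=> u -> [v ->]; exists (v + u); rewrite mulrnDl addrA. Qed.

Lemma cong_add m x x' y y' : cong m x x' -> cong m y y' -> cong m (x + y) (x' + y').
Proof. by case=> u -> [v ->]; exists (u + v); rewrite mulrnDl addrACA. Qed.

Lemma cong_opp m x x' : cong m x x' -> cong m (- x) (- x').
Proof. by case=> u ->; exists (- u); rewrite mulNrn opprD. Qed.

Lemma cong_mul m x x' y y' : cong m x x' -> cong m y y' -> cong m (x * y) (x' * y').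
Proof.
case=> u -> [v ->]; exists (x' * v + u * y' + u * v *+ m).
by rewrite mulrDl !mulrDr !mulrnDl !mulrnAl !mulrnAr !addrA.
Qed.

Lemma cong_exp m x y n : cong m x y -> cong m (x ^+ n) (y ^+ n).
Proof.
move=> xy; elim: n => [|n IHn]; first exact: cong_refl.
by rewrite !exprS; apply: cong_mul.
Qed.

Lemma cong_muln m n x y : cong m x y -> cong (m * n) (x *+ n) (y *+ n).
Proof. by case=> z ->; exists z; rewrite mulrnDl mulrnA. Qed.

Lemma cong_dvd m n x y : (m %| n)%N -> cong n x y -> cong m x y.
Proof. by case/dvdnP=> q -> [z ->]; exists (z *+ q); rewrite mulrnA. Qed.

Lemma cong_sum m n (F G : nat -> A) :
  (forall i, (i < n)%N -> cong m (F i) (G i)) ->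
  cong m (\sum_(i < n) F i) (\sum_(i < n) G i).
Proof.
elim: n => [|n IHn] FG; first by rewrite !big_ord0; apply: cong_refl.
rewrite !big_ord_recr /=; apply: cong_add; last exact: FG.
by apply: IHn => i ni; apply: FG; apply: ltnW.
Qed.

Variables (p : nat) (p_pr : prime p).

Lemma cong_expp m x y : (0 < m)%N -> cong (p ^ m) x y ->
  cong (p ^ m.+1) (x ^+ p) (y ^+ p).
Proof.
move=> m_gt0 [z ->]; rewrite exprDn.
rewrite big_ord_recl /= subn0 expr0 mulr1 bin0 mulr1n.
pose F i := (y ^+ (p - bump 0 i) * (z *+ p ^ m) ^+ bump 0 i) *+ 'C(p, bump 0 i).
suff [w E] : cong (p ^ m.+1) (\sum_(i < p) F i) 0 by rewrite E; exists w; rewrite add0r.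
have CS := @cong_sum (p ^ m.+1) p F (fun _ => 0).
rewrite sumr_const mul0rn in CS; apply: CS => i ip.
rewrite /F /bump /= add1n exprMn_n mulrnAr -mulrnA.
have D : (p ^ m.+1 %| (p ^ m) ^ i.+1 * 'C(p, i.+1))%N.
  have [ip1|ip1] := ltnP i.+1 p.
    rewrite expnSr dvdn_mul ?prime_dvd_bin //.
    by rewrite expnS dvdn_mulr.
  rewrite dvdn_mulr // -expnM dvdn_exp2l //.
  by rewrite ltn_Pmulr // (leq_trans (prime_gt1 p_pr)).
case/dvdnP: D => q ->; exists (y ^+ (p - i.+1) * z ^+ i.+1 *+ q).
by rewrite add0r mulrnA.
Qed.

Lemma cong_exppX m n x y : (0 < m)%N -> cong (p ^ m) x y ->
  cong (p ^ (m + n)) (x ^+ (p ^ n)) (y ^+ (p ^ n)).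
Proof.
move=> m_gt0 xy; elim: n => [|n IHn]; first by rewrite addn0 expn0 !expr1.
by rewrite addnS (expnSr p n) !exprM; apply: cong_expp; rewrite ?addn_gt0 ?m_gt0.
Qed.

End Congruence.

(* w_n(a) = sum_(i <= n) p^i a_i^(p^(n-i)) *)
Definition ghost (p : nat) (B : pzSemiRingType) (a : nat -> B) (n : nat) : B :=
  \sum_(i < n.+1) a i ^+ (p ^ (n - i)) *+ p ^ i.

Section Ghost.
Variables (p : nat) (p_pr : prime p).

Lemma rmorph_ghost (A B : comPzRingType) (f : {rmorphism A -> B}) (a : nat -> A) n :
  f (ghost p a n) = ghost p (f \o a) n.
Proof.
by rewrite /ghost rmorph_sum; apply: eq_bigr => i _; rewrite rmorphMn rmorphXn.
Qed.

Lemma eq_ghost (B : comPzRingType) (a b : nat -> B) n :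
  (forall i, (i <= n)%N -> a i = b i) -> ghost p a n = ghost p b n.
Proof. by move=> ab; apply: eq_bigr => i _; rewrite ab // -ltnS. Qed.

Lemma ghostS (B : comPzRingType) (a : nat -> B) n : ghost p a n =
  \sum_(i < n) a i ^+ (p ^ (n - i)) *+ p ^ i + a n *+ p ^ n.
Proof. by rewrite /ghost big_ord_recr /= subnn expn0 expr1. Qed.

(* Dwork's lemma: in a p-torsion-free ring with a lift phi of the p-th power map, *)
(* g is a ghost vector as soon as g_(n+1) = phi(g_n) mod p^(n+1).               *)
Section TorsionFree.
Variables (A : comPzRingType) (A_tf : forall x : A, x *+ p = 0 -> x = 0).

Lemma tfX n (x y : A) : x *+ p ^ n = y *+ p ^ n -> x = y.
Proof.
move=> /eqP; rewrite -subr_eq0 -mulrnBl => /eqP xy.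
apply/eqP; rewrite -subr_eq0; apply/eqP; move: (x - y) xy => {x y} x.
by elim: n => [|n IHn]; rewrite ?expn0 // expnSr mulrnA => /A_tf.
Qed.

Lemma ghost_inj n (a b : nat -> A) :
  (forall i, (i <= n)%N -> ghost p a i = ghost p b i) ->
  forall i, (i <= n)%N -> a i = b i.
Proof.
move=> ab i; elim/ltn_ind: i => i IHi lin.
have := ab i lin; rewrite !ghostS.
under eq_bigr => j _ do rewrite IHi // ?(ltnW (leq_trans (ltn_ord j) lin)) //.
by move=> /addrI /tfX.
Qed.

Variables (phi : {rmorphism A -> A}) (phiP : forall x, cong p (phi x) (x ^+ p)).

Lemma ghost_cong (a : nat -> A) n :
  cong (p ^ n.+1) (\sum_(i < n.+1) a i ^+ (p ^ (n.+1 - i)) *+ p ^ i)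
    (phi (ghost p a n)).
Proof.
rewrite rmorph_sum.
rewrite [X in cong _ _ X](eq_bigr (fun i : 'I_n.+1 => phi (a i) ^+ (p ^ (n - i)) *+ p ^ i)); last first.
  by move=> i _; rewrite rmorphMn rmorphXn.
apply: (@cong_sum _ _ _ (fun i => a i ^+ (p ^ (n.+1 - i)) *+ p ^ i)
  (fun i => phi (a i) ^+ (p ^ (n - i)) *+ p ^ i)) => i; rewrite ltnS => lin.
have -> : (p ^ n.+1 = p ^ (1 + (n - i)) * p ^ i)%N by rewrite -expnD add1n addSn subnK.
apply: cong_muln.
have -> : a i ^+ (p ^ (n.+1 - i)) = (a i ^+ p) ^+ (p ^ (n - i)) by rewrite subSn // expnS exprM.
apply: cong_exppX => //.
by rewrite expn1; apply: cong_sym.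
Qed.

Lemma ghost_dwork (a : nat -> A) n :
  cong (p ^ n.+1) (ghost p a n.+1) (phi (ghost p a n)).
Proof.
rewrite ghostS; apply: (cong_trans _ (ghost_cong a n)).
by exists (a n.+1).
Qed.

Lemma dwork (g : nat -> A) :
  (forall n, cong (p ^ n.+1) (g n.+1) (phi (g n))) ->
  exists a, forall n, ghost p a n = g n.
Proof.
move=> gP.
have fin n : exists a, forall i, (i <= n)%N -> ghost p a i = g i.
  elim: n => [|n [a aP]].
    exists (fun=> g 0%N) => i; rewrite leqn0 => /eqP ->.
    by rewrite ghostS big_ord0 add0r expn0.
  have [z zP] : cong (p ^ n.+1) (g n.+1) (\sum_(i < n.+1) a i ^+ (p ^ (n.+1 - i)) *+ p ^ i).
    apply: (cong_trans (gP n)); rewrite -aP //; apply: cong_sym; exact: ghost_cong.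
  exists (fun i => if (i <= n)%N then a i else z) => i; rewrite leq_eqVlt => /orP[/eqP->|].
    rewrite ghostS ltnn zP; congr (_ + _); apply: eq_bigr => j _.
    by rewrite -ltnS ltn_ord.
  rewrite ltnS => lin; rewrite -aP //; apply: eq_ghost => j ji.
  by rewrite (leq_trans ji lin).
have [s sP] := choice fin.
exists (fun n => s n n) => n; rewrite -(sP n n) //; apply: eq_ghost => i lin.
apply: (@ghost_inj i) => // j ji; rewrite !sP //; exact: leq_trans ji lin.
Qed.

End TorsionFree.
End Ghost.

Section FrobeniusLift.
Variables (p : nat) (p_pr : prime p).

Lemma cong_expD (A : comPzRingType) (x y : A) :
  cong p ((x + y) ^+ p) (x ^+ p + y ^+ p).
Proof.
pose F i := x ^+ (p - i) * y ^+ i *+ 'C(p, i).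
have Fsum : \sum_(i < p.+1) F i = F 0%N + (\sum_(i < p.-1) F i.+1 + F p).
  rewrite -(big_mkord predT F) big_nat_recl // -{1}[p]prednK ?prime_gt0 //.
  by rewrite big_nat_recr // (prednK (prime_gt0 p_pr)) /= big_mkord.
rewrite exprDn Fsum /F subn0 expr0 mulr1 bin0 mulr1n subnn expr0 binn mul1r mulr1n.
apply: cong_add; first exact: cong_refl.
rewrite -[X in cong _ _ X]add0r; apply: cong_add; last exact: cong_refl.
have CS := @cong_sum _ p p.-1 (fun i => F i.+1) (fun _ => 0).
rewrite sumr_const mul0rn in CS; apply: CS => i ip.
have /dvdnP[q qE] : (p %| 'C(p, i.+1))%N.
  by rewrite prime_dvd_bin //= -ltn_predRL.
by rewrite /F qE; exists (x ^+ (p - i.+1) * y ^+ i.+1 *+ q); rewrite add0r mulrnA.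
Qed.

Definition phiZ : {rmorphism polyZ -> polyZ} := peval (fun j i => polyX j i ^+ p).

Lemma phiZP (f : polyZ) : cong p (phiZ f) (f ^+ p).
Proof.
elim/polyZ_ind: f => [|f g IHf IHg|f g IHf IHg|j i].
- by rewrite rmorph1 expr1n; apply: cong_refl.
- rewrite rmorphB; apply: cong_trans (cong_sym (cong_expD _ _)).
  apply: cong_add; first exact: IHf.
  apply: (cong_trans (cong_opp IHg)).
  have := cong_expD g (- g); rewrite subrr expr0n gtn_eqF ?prime_gt0 //=.
  move=> /(cong_add (cong_refl p (- g ^+ p))).
  by rewrite addr0 addrA addNr add0r.
- by rewrite rmorphM exprMn; apply: cong_mul.
- by rewrite /phiZ pevalX; apply: cong_refl.
Qed.

Lemma polyZ_tf (f : polyZ) : f *+ p = 0 -> f = 0.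
Proof. exact/polyZ_torsion/prime_gt0. Qed.

Lemma polyZ_dwork (g : nat -> polyZ) :
  (forall n, cong (p ^ n.+1) (g n.+1) (phiZ (g n))) ->
  exists a, forall n, ghost p a n = g n.
Proof. exact: (dwork p_pr polyZ_tf phiZP). Qed.

Lemma polyZ_ghost_cong (a : nat -> polyZ) n :
  cong (p ^ n.+1) (ghost p a n.+1) (phiZ (ghost p a n)).
Proof. exact: (ghost_dwork p_pr phiZP). Qed.

End FrobeniusLift.

Section WittPolynomials.
Variables (p : nat) (p_pr : prime p).
Local Notation gh := (ghost p).
Local Notation X := polyX.

Fact witt_add_ex : exists S, forall n, gh S n = gh (X 0) n + gh (X 1) n.
Proof.
apply: (polyZ_dwork p_pr) => n; rewrite rmorphD.
by apply: cong_add; apply: polyZ_ghost_cong.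
Qed.
Fact witt_opp_ex : exists S, forall n, gh S n = - gh (X 0) n.
Proof.
apply: (polyZ_dwork p_pr) => n; rewrite rmorphN.
by apply: cong_opp; apply: polyZ_ghost_cong.
Qed.
Fact witt_mul_ex : exists S, forall n, gh S n = gh (X 0) n * gh (X 1) n.
Proof.
apply: (polyZ_dwork p_pr) => n; rewrite rmorphM.
by apply: cong_mul; apply: polyZ_ghost_cong.
Qed.
Fact witt_frob_ex : exists S, forall n, gh S n = gh (X 0) n.+1.
Proof.
apply: (polyZ_dwork p_pr) => n.
apply: (cong_dvd _ (polyZ_ghost_cong p_pr _ _)).
by rewrite dvdn_exp2l.
Qed.

(* polyZ is p-torsion free, so each of the following sequences is unique: these *)
(* are the Witt polynomials of the sum, the opposite, the product and of F.     *)
Definition witt_addP := sval (cid witt_add_ex).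
Definition witt_oppP := sval (cid witt_opp_ex).
Definition witt_mulP := sval (cid witt_mul_ex).
Definition witt_frobP := sval (cid witt_frob_ex).
End WittPolynomials.

(* W(B), the limit of the W_n(B), in Witt coordinates; p_pr is a phantom         *)
(* parameter that keys the ring structure.                                      *)
Record witt (p : nat) (p_pr : prime p) (B : Type) := Witt { wcoef :> nat -> B }.

Section WittOps.
Variables (p : nat) (p_pr : prime p).
Local Notation W B := (witt p_pr B).
Local Notation gh := (ghost p).
Local Notation X := polyX.

Lemma wittP (B : Type) (a b : W B) : (forall n, a n = b n) -> a = b.
Proof. by case: a b => a [b] /= ab; congr Witt; apply/funext. Qed.

HB.instance Definition _ (B : Type) := gen_eqMixin (W B).
HB.instance Definition _ (B : Type) := gen_choiceMixin (W B).

Definition vars (B : Type) (a b c : nat -> B) (j : nat) : nat -> B :=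
  match j with 0 => a | 1 => b | _ => c end.

Section Ops.
Variable B : comPzRingType.
Implicit Types a b c : W B.
Definition wzero : W B := Witt p_pr (fun _ => 0).
Definition wone : W B := Witt p_pr (fun n => (n == 0%N)%:R).
Definition wadd a b : W B :=
  Witt p_pr (fun n => peval (vars a b b) (witt_addP p_pr n)).
Definition wopp a : W B :=
  Witt p_pr (fun n => peval (vars a a a) (witt_oppP p_pr n)).
Definition wmul a b : W B :=
  Witt p_pr (fun n => peval (vars a b b) (witt_mulP p_pr n)).
Definition wfrob a : W B :=
  Witt p_pr (fun n => peval (vars a a a) (witt_frobP p_pr n)).

Lemma peval_ghost (v : nat -> nat -> B) (S : nat -> polyZ) n :
  gh (fun n => peval v (S n)) n = peval v (gh S n).
Proof. by rewrite rmorph_ghost. Qed.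

Lemma peval_ghostX (v : nat -> nat -> B) j n : peval v (gh (X j) n) = gh (v j) n.
Proof. by rewrite rmorph_ghost; apply: eq_ghost => i _ /=; rewrite pevalX. Qed.

Lemma ghost_wzero n : gh wzero n = 0.
Proof. by rewrite /ghost big1 // => i _; rewrite expr0n expn_eq0 (gtn_eqF (prime_gt0 p_pr)) mul0rn. Qed.

Lemma ghost_wone n : gh wone n = 1.
Proof.
rewrite /ghost big_ord_recl big1 /= => [|i _].
  by rewrite expr1n addr0 expn0.
by rewrite mulr0n expr0n expn_eq0 (gtn_eqF (prime_gt0 p_pr)) mul0rn.
Qed.

Lemma ghost_wadd a b n : gh (wadd a b) n = gh a n + gh b n.
Proof. by rewrite peval_ghost (svalP (cid (witt_add_ex p_pr))) rmorphD /= !peval_ghostX. Qed.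
Lemma ghost_wopp a n : gh (wopp a) n = - gh a n.
Proof. by rewrite peval_ghost (svalP (cid (witt_opp_ex p_pr))) rmorphN /= !peval_ghostX. Qed.
Lemma ghost_wmul a b n : gh (wmul a b) n = gh a n * gh b n.
Proof. by rewrite peval_ghost (svalP (cid (witt_mul_ex p_pr))) rmorphM /= !peval_ghostX. Qed.
Lemma ghost_wfrob a n : gh (wfrob a) n = gh a n.+1.
Proof. by rewrite peval_ghost (svalP (cid (witt_frob_ex p_pr))) /= !peval_ghostX. Qed.
End Ops.

Definition wfun (A B : Type) (f : A -> B) (a : W A) : W B := Witt p_pr (f \o a).

Lemma ghost_wfun (A B : comPzRingType) (f : {rmorphism A -> B}) (a : W A) n :
  gh (wfun f a) n = f (gh a n).
Proof. by rewrite rmorph_ghost. Qed.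

Lemma peval_comp (A B : comPzRingType) (f : {rmorphism A -> B}) v w :
  (forall j i, f (v j i) = w j i) -> forall g, f (peval v g) = peval w g.
Proof.
move=> fvw; apply: (@polyZ_ext _ (f \o peval v) (peval w)) => j i /=.
by rewrite !pevalX.
Qed.

Section Natural.
Variables (A B : comPzRingType) (f : {rmorphism A -> B}).
Lemma wfun0 : wfun f (wzero A) = wzero B.
Proof. by apply: wittP => n /=; rewrite rmorph0. Qed.
Lemma wfun1 : wfun f (wone A) = wone B.
Proof. by apply: wittP => n /=; rewrite rmorph_nat. Qed.
Lemma wfunD a b : wfun f (wadd a b) = wadd (wfun f a) (wfun f b).
Proof. by apply: wittP => n; apply: peval_comp => -[|[|]]. Qed.
Lemma wfunN a : wfun f (wopp a) = wopp (wfun f a).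
Proof. by apply: wittP => n; apply: peval_comp => -[|[|]]. Qed.
Lemma wfunM a b : wfun f (wmul a b) = wmul (wfun f a) (wfun f b).
Proof. by apply: wittP => n; apply: peval_comp => -[|[|]]. Qed.
Lemma wfunF a : wfun f (wfrob a) = wfrob (wfun f a).
Proof. by apply: wittP => n; apply: peval_comp => -[|[|]]. Qed.
End Natural.

Lemma wghost_inj (a b : W polyZ) : (forall n, gh a n = gh b n) -> a = b.
Proof.
move=> ab; apply: wittP => n.
exact: (@ghost_inj p _ (polyZ_tf p_pr) n).
Qed.

Definition wX j : W polyZ := Witt p_pr (X j).

Lemma wfun_wX (B : comPzRingType) (v : nat -> nat -> B) j :
  wfun (peval v) (wX j) = Witt p_pr (v j).
Proof. by apply: wittP => n /=; rewrite pevalX. Qed.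

Lemma witt_lift (B : comPzRingType) (a b c : W B) : exists f : {rmorphism polyZ -> B},
  [/\ a = wfun f (wX 0), b = wfun f (wX 1) & c = wfun f (wX 2)].
Proof.
exists (peval (vars a b c)); rewrite !wfun_wX.
by case: a b c => a [b] [c].
Qed.

Lemma waddA B : associative (@wadd B).
Proof.
move=> a b c; have [f [-> -> ->]] := witt_lift a b c; rewrite -!wfunD.
by congr wfun; apply: wghost_inj => n; rewrite !ghost_wadd addrA.
Qed.
Lemma waddC B : commutative (@wadd B).
Proof.
move=> a b; have [f [-> -> _]] := witt_lift a b b; rewrite -!wfunD.
by congr wfun; apply: wghost_inj => n; rewrite !ghost_wadd addrC.
Qed.
Lemma wadd0 B : left_id (wzero B) (@wadd B).
Proof.
move=> a; have [f [-> _ _]] := witt_lift a a a; rewrite -(wfun0 f) -!wfunD.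
by congr wfun; apply: wghost_inj => n; rewrite !ghost_wadd ghost_wzero add0r.
Qed.
Lemma waddN B : left_inverse (wzero B) (@wopp B) (@wadd B).
Proof.
move=> a; have [f [-> _ _]] := witt_lift a a a; rewrite -(wfun0 f) -wfunN -!wfunD.
by congr wfun; apply: wghost_inj => n; rewrite !ghost_wadd ghost_wopp ghost_wzero addNr.
Qed.
Lemma wmulA B : associative (@wmul B).
Proof.
move=> a b c; have [f [-> -> ->]] := witt_lift a b c; rewrite -!wfunM.
by congr wfun; apply: wghost_inj => n; rewrite !ghost_wmul mulrA.
Qed.
Lemma wmulC B : commutative (@wmul B).
Proof.
move=> a b; have [f [-> -> _]] := witt_lift a b b; rewrite -!wfunM.
by congr wfun; apply: wghost_inj => n; rewrite !ghost_wmul mulrC.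
Qed.
Lemma wmul1 B : left_id (wone B) (@wmul B).
Proof.
move=> a; have [f [-> _ _]] := witt_lift a a a; rewrite -(wfun1 f) -!wfunM.
by congr wfun; apply: wghost_inj => n; rewrite !ghost_wmul ghost_wone mul1r.
Qed.
Lemma wmulDl B : left_distributive (@wmul B) (@wadd B).
Proof.
move=> a b c; have [f [-> -> ->]] := witt_lift a b c; rewrite -wfunD -!wfunM -wfunD.
by congr wfun; apply: wghost_inj => n; rewrite !(ghost_wmul, ghost_wadd) mulrDl.
Qed.

HB.instance Definition _ (B : comPzRingType) :=
  GRing.isZmodule.Build (W B) (@waddA B) (@waddC B) (@wadd0 B) (@waddN B).
HB.instance Definition _ (B : comPzRingType) :=
  GRing.Zmodule_isComPzRing.Build (W B) (@wmulA B) (@wmulC B) (@wmul1 B) (@wmulDl B).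
End WittOps.

Section WittRing.
Variables (p : nat) (p_pr : prime p).
Local Notation W := (witt p_pr).
Local Notation gh := (ghost p).

Lemma ghostB (B : comPzRingType) n : zmod_morphism (fun a : W B => gh a n).
Proof. by move=> a b; rewrite ghost_wadd ghost_wopp. Qed.
Lemma ghostM (B : comPzRingType) n : monoid_morphism (fun a : W B => gh a n).
Proof. by split=> [|a b]; rewrite ?ghost_wone ?ghost_wmul. Qed.

Definition wghost (B : comPzRingType) n (a : W B) : B := gh a n.
HB.instance Definition _ (B : comPzRingType) n :=
  GRing.isZmodMorphism.Build _ _ (@wghost B n) (@ghostB B n).
HB.instance Definition _ (B : comPzRingType) n :=
  GRing.isMonoidMorphism.Build _ _ (@wghost B n) (@ghostM B n).

Lemma wghostI (a b : W polyZ) : (forall n, wghost n a = wghost n b) -> a = b.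
Proof. exact: wghost_inj. Qed.

Section Map.
Variables (A B : comPzRingType) (f : {rmorphism A -> B}).
Lemma wfun_zmod : zmod_morphism (@wfun p p_pr A B f).
Proof. by move=> a b; rewrite wfunD wfunN. Qed.
Lemma wfun_monoid : monoid_morphism (@wfun p p_pr A B f).
Proof. by split=> [|a b]; rewrite ?wfun1 ?wfunM. Qed.
Definition wmap : {rmorphism W A -> W B} := HB.pack (@wfun p p_pr A B f)
  (GRing.isZmodMorphism.Build _ _ _ wfun_zmod)
  (GRing.isMonoidMorphism.Build _ _ _ wfun_monoid).
Lemma wmapE a n : wmap a n = f (a n). Proof. by []. Qed.
Lemma wghost_wmap n a : wghost n (wmap a) = f (wghost n a).
Proof. exact: ghost_wfun. Qed.
End Map.

Lemma witt_lift2 (B : comPzRingType) (a b : W B) :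
  exists f : {rmorphism polyZ -> B}, exists x y, a = wmap f x /\ b = wmap f y.
Proof.
have [f [-> -> _]] := witt_lift a b b.
by exists f, (wX p_pr 0), (wX p_pr 1).
Qed.

Lemma wmap_frob (A B : comPzRingType) (f : {rmorphism A -> B}) (a : W A) :
  wmap f (wfrob a) = wfrob (wmap f a).
Proof. exact: wfunF. Qed.

Lemma wghost_frob (B : comPzRingType) n (a : W B) : wghost n (wfrob a) = wghost n.+1 a.
Proof. exact: ghost_wfrob. Qed.

Lemma wfrob_zmod (B : comPzRingType) : zmod_morphism (@wfrob p p_pr B).
Proof.
move=> a b; have [f [x [y [-> ->]]]] := witt_lift2 a b.
rewrite -rmorphB -!wmap_frob -rmorphB; congr (wmap f _).
by apply: wghostI => n; rewrite wghost_frob !rmorphB /= !wghost_frob.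
Qed.
Lemma wfrob_monoid (B : comPzRingType) : monoid_morphism (@wfrob p p_pr B).
Proof.
split=> [|a b].
  rewrite -(rmorph1 (wmap (peval (fun _ _ => 0 : B)))) -wmap_frob; congr (wmap _ _).
  by apply: wghostI => n; rewrite wghost_frob !rmorph1.
have [f [x [y [-> ->]]]] := witt_lift2 a b.
rewrite -rmorphM -!wmap_frob -rmorphM; congr (wmap f _).
by apply: wghostI => n; rewrite wghost_frob !rmorphM /= !wghost_frob.
Qed.
Definition frob (B : comPzRingType) : {rmorphism W B -> W B} := HB.pack (@wfrob p p_pr B)
  (GRing.isZmodMorphism.Build _ _ _ (@wfrob_zmod B))
  (GRing.isMonoidMorphism.Build _ _ _ (@wfrob_monoid B)).

Lemma wghost_wfrob (B : comPzRingType) n (a : W B) : wghost n (frob B a) = wghost n.+1 a.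
Proof. exact: ghost_wfrob. Qed.

Lemma wmap_wfrob (A B : comPzRingType) (f : {rmorphism A -> B}) (a : W A) :
  wmap f (frob A a) = frob B (wmap f a).
Proof. exact: wfunF. Qed.

Lemma wpoly_tf (a : W polyZ) : a *+ p = 0 -> a = 0.
Proof.
move=> a0; apply: wghostI => n; rewrite rmorph0.
by apply: (polyZ_tf p_pr); rewrite -rmorphMn a0 rmorph0.
Qed.

Lemma wpoly_frob (a : W polyZ) : cong p (frob _ a) (a ^+ p).
Proof.
have /choice[g gP] : forall n, exists z, wghost n.+1 a = wghost n a ^+ p + z *+ p.
  move=> n; apply: (@cong_trans _ p (phiZ p (wghost n a))); last exact: phiZP.
  apply: (cong_dvd _ (polyZ_ghost_cong p_pr a n)); exact: dvdn_exp.
have [b bP] : exists b, forall n, gh b n = g n.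
  apply: (polyZ_dwork p_pr) => n.
  have [z zP] : cong (p ^ n.+2) (g n.+1 *+ p) (phiZ p (g n) *+ p).
    have G m : g m *+ p = wghost m.+1 a - wghost m a ^+ p.
      by rewrite gP addrC addKr.
    rewrite -rmorphMn !G rmorphB rmorphXn; apply: cong_add.
      exact: polyZ_ghost_cong.
    by apply/cong_opp/(cong_expp p_pr) => //; exact: polyZ_ghost_cong.
  exists z; apply/eqP; rewrite -subr_eq0; apply/eqP/(polyZ_tf p_pr).
  by rewrite mulrnBl zP mulrnDl -mulrnA -expnSr subrr.
exists (Witt p_pr b); apply: wghostI => n.
by rewrite wghost_wfrob rmorphD rmorphXn rmorphMn /= gP /wghost /= bP.
Qed.

Fact wdelta_ex : exists D : nat -> W polyZ,
  forall n, gh D n = iter n (frob _) (wX p_pr 0).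
Proof.
by apply: (dwork p_pr wpoly_tf wpoly_frob) => n /=; apply: cong_refl.
Qed.

(* The unique element of W(W(polyZ)) with ghost components F^n(X_0);            *)
(* specializing X_0 to a gives wdelta a, with ghost components F^n(a).           *)
Definition wdelta_poly : W (W polyZ) := Witt p_pr (sval (cid wdelta_ex)).

Lemma wghost_wdelta_poly n : wghost n wdelta_poly = iter n (frob _) (wX p_pr 0).
Proof. exact: (svalP (cid wdelta_ex)). Qed.

Definition wdelta_fun (B : comPzRingType) (a : W B) : W (W B) :=
  wmap (wmap (peval (fun _ => a))) wdelta_poly.

Lemma wmap_wX (B : comPzRingType) (a : W B) :
  wmap (peval (fun _ => a)) (wX p_pr 0) = a.
Proof. by rewrite /= wfun_wX; case: a. Qed.

Lemma iter_frob_wmap (A B : comPzRingType) (f : {rmorphism A -> B}) (a : W A) n :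
  wmap f (iter n (frob A) a) = iter n (frob B) (wmap f a).
Proof. by elim: n => // n IHn; rewrite !iterS wmap_wfrob IHn. Qed.

Lemma wghost_wdelta_fun (B : comPzRingType) (a : W B) n :
  wghost n (wdelta_fun a) = iter n (frob B) a.
Proof.
by rewrite wghost_wmap wghost_wdelta_poly iter_frob_wmap wmap_wX.
Qed.

Lemma wmap_wdelta_fun (A B : comPzRingType) (f : {rmorphism A -> B}) (a : W A) :
  wmap (wmap f) (wdelta_fun a) = wdelta_fun (wmap f a).
Proof.
apply: wittP => n; rewrite !wmapE; apply: wittP => m; rewrite !wmapE.
by apply: peval_comp.
Qed.

Lemma wwghost_inj (a b : W (W polyZ)) : (forall n, wghost n a = wghost n b) -> a = b.
Proof.
move=> ab; apply: wittP => n; exact: (@ghost_inj p _ wpoly_tf n a b (fun i _ => ab i) n (leqnn n)).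
Qed.

Lemma iter_frobD (B : comPzRingType) n : zmod_morphism (iter n (frob B)).
Proof. by elim: n => // n IHn a b; rewrite !iterS IHn rmorphB. Qed.
Lemma iter_frobM (B : comPzRingType) n : monoid_morphism (iter n (frob B)).
Proof.
split; elim: n => // n IHn; first by rewrite iterS IHn rmorph1.
by move=> a b; rewrite !iterS IHn rmorphM.
Qed.

Lemma wdelta_zmod (B : comPzRingType) : zmod_morphism (@wdelta_fun B).
Proof.
move=> a b; have [f [x [y [-> ->]]]] := witt_lift2 a b.
rewrite -rmorphB -!wmap_wdelta_fun -rmorphB; congr (wmap _ _).
by apply: wwghost_inj => n; rewrite rmorphB /= !wghost_wdelta_fun iter_frobD.
Qed.
Lemma wdelta_monoid (B : comPzRingType) : monoid_morphism (@wdelta_fun B).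
Proof.
split=> [|a b].
  rewrite -(rmorph1 (wmap (peval (fun _ _ => 0 : B)))) -wmap_wdelta_fun.
  rewrite -(rmorph1 (wmap (wmap (peval (fun _ _ => 0 : B))))); congr (wmap _ _).
  by apply: wwghost_inj => n; rewrite wghost_wdelta_fun (iter_frobM _ _).1 rmorph1.
have [f [x [y [-> ->]]]] := witt_lift2 a b.
rewrite -rmorphM -!wmap_wdelta_fun -rmorphM; congr (wmap _ _).
by apply: wwghost_inj => n; rewrite rmorphM /= !wghost_wdelta_fun (iter_frobM _ _).2.
Qed.
Definition wdelta (B : comPzRingType) : {rmorphism W B -> W (W B)} :=
  HB.pack (@wdelta_fun B)
  (GRing.isZmodMorphism.Build _ _ _ (@wdelta_zmod B))
  (GRing.isMonoidMorphism.Build _ _ _ (@wdelta_monoid B)).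

Lemma wghost_wdelta (B : comPzRingType) n (a : W B) :
  wghost n (wdelta B a) = iter n (frob B) a.
Proof. exact: wghost_wdelta_fun. Qed.

Lemma wdelta_unique (B : comPzRingType) (f : W B -> W (W B)) :
  (forall x : W B, x *+ p = 0 -> x = 0) ->
  (forall n a, wghost n (f a) = iter n (frob B) a) -> f =1 wdelta B.
Proof.
move=> tf fP a; apply: wittP => n.
apply: (@ghost_inj p _ tf n (f a) (wdelta B a) _ n (leqnn n)) => i _.
exact: etrans (fP i a) (esym (wghost_wdelta i a)).
Qed.

End WittRing.

(* W_n(B) has length n + 1. Its operations are those of W(B) followed by          *)
(* truncation, which only involves the coordinates of index at most n.           *)
Record wittn (p : nat) (p_pr : prime p) (n : nat) (B : Type) :=
  WittN { wncoef :> 'I_n.+1 -> B }.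

Section Truncated.
Variables (p : nat) (p_pr : prime p) (n : nat).
Local Notation W := (witt p_pr).
Local Notation Wn := (wittn p_pr n).

Lemma wittnP (B : Type) (a b : Wn B) : (forall i, a i = b i) -> a = b.
Proof. by case: a b => a [b] /= ab; congr WittN; apply/funext. Qed.

HB.instance Definition _ (B : Type) := gen_eqMixin (Wn B).
HB.instance Definition _ (B : Type) := gen_choiceMixin (Wn B).

Definition wtrunc_fun (B : Type) (a : W B) : Wn B := WittN p_pr (fun i : 'I_n.+1 => a i).

Section Ops.
Variable B : comPzRingType.

Definition wext (a : Wn B) : W B :=
  Witt p_pr (fun i => if insub i is Some j then a j else 0).

Lemma wextK : cancel wext (@wtrunc_fun B).
Proof. by move=> a; apply: wittnP => i /=; rewrite insubT //= => ?; congr (a _); apply: val_inj. Qed.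

Definition wnadd (a b : Wn B) := wtrunc_fun (wext a + wext b).
Definition wnopp (a : Wn B) := wtrunc_fun (- wext a).
Definition wnmul (a b : Wn B) := wtrunc_fun (wext a * wext b).

Definition trunc_var (j i : nat) : polyZ := if (i <= n)%N then polyX j i else 0.

Lemma ghost_trunc (S T : nat -> polyZ) : 
  (forall i, (i <= n)%N -> ghost p S i = ghost p T i) -> forall i, (i <= n)%N -> S i = T i.
Proof. exact: (ghost_inj (polyZ_tf p_pr)). Qed.

Lemma peval_trunc (v w : nat -> nat -> B) (f : polyZ) :
  (forall j i, (i <= n)%N -> v j i = w j i) ->
  peval trunc_var f = f -> peval v f = peval w f.
Proof.
move=> vw <-.
have E (u : nat -> nat -> B) : peval u (peval trunc_var f) =
    peval (fun j i => if (i <= n)%N then u j i else 0) f.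
  apply: peval_comp => j i; rewrite /trunc_var; case: ifP => _; rewrite ?pevalX //.
  exact: rmorph0.
rewrite !E; congr (peval _ f); apply/funext => j; apply/funext => i.
by case: ifP => // /vw.
Qed.

Lemma ghost_truncX j i : (i <= n)%N ->
  peval trunc_var (ghost p (polyX j) i) = ghost p (polyX j) i.
Proof.
move=> lin; rewrite peval_ghostX; apply: eq_ghost => k ki.
by rewrite /trunc_var (leq_trans ki lin).
Qed.

Lemma wtrunc_add (a b a' b' : W B) :
  wtrunc_fun a = wtrunc_fun a' -> wtrunc_fun b = wtrunc_fun b' ->
  wtrunc_fun (a + b) = wtrunc_fun (a' + b').
Proof.
move=> [aa] [bb]; apply: wittnP => i /=.
apply: peval_trunc => [j k kn|].
  pose o := Ordinal (kn : (k < n.+1)%N).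
  have := congr1 (@^~ o) aa; have := congr1 (@^~ o) bb.
  by rewrite /= => eb ea; case: j => [|[|j]].
move: (i : nat) (leq_ord i) => {}i lin.
apply: (@ghost_trunc (fun k => peval trunc_var (witt_addP p_pr k))) lin => k lkn.
rewrite peval_ghost (svalP (cid (witt_add_ex p_pr))).
by rewrite rmorphD /= !ghost_truncX.
Qed.

Lemma wtrunc_opp (a a' : W B) :
  wtrunc_fun a = wtrunc_fun a' -> wtrunc_fun (- a) = wtrunc_fun (- a').
Proof.
move=> [aa]; apply: wittnP => i /=.
apply: peval_trunc => [j k kn|].
  pose o := Ordinal (kn : (k < n.+1)%N).
  have := congr1 (@^~ o) aa.
  by rewrite /= => ea; case: j => [|[|j]].
move: (i : nat) (leq_ord i) => {}i lin.
apply: (@ghost_trunc (fun k => peval trunc_var (witt_oppP p_pr k))) lin => k lkn.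
rewrite peval_ghost (svalP (cid (witt_opp_ex p_pr))).
by rewrite rmorphN /= !ghost_truncX.
Qed.

Lemma wtrunc_mul (a b a' b' : W B) :
  wtrunc_fun a = wtrunc_fun a' -> wtrunc_fun b = wtrunc_fun b' ->
  wtrunc_fun (a * b) = wtrunc_fun (a' * b').
Proof.
move=> [aa] [bb]; apply: wittnP => i /=.
apply: peval_trunc => [j k kn|].
  pose o := Ordinal (kn : (k < n.+1)%N).
  have := congr1 (@^~ o) aa; have := congr1 (@^~ o) bb.
  by rewrite /= => eb ea; case: j => [|[|j]].
move: (i : nat) (leq_ord i) => {}i lin.
apply: (@ghost_trunc (fun k => peval trunc_var (witt_mulP p_pr k))) lin => k lkn.
rewrite peval_ghost (svalP (cid (witt_mul_ex p_pr))).
by rewrite rmorphM /= !ghost_truncX.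
Qed.

Lemma wnaddE (a b : W B) : wnadd (wtrunc_fun a) (wtrunc_fun b) = wtrunc_fun (a + b).
Proof. by apply: wtrunc_add; rewrite wextK. Qed.
Lemma wnoppE (a : W B) : wnopp (wtrunc_fun a) = wtrunc_fun (- a).
Proof. by apply: wtrunc_opp; rewrite wextK. Qed.
Lemma wnmulE (a b : W B) : wnmul (wtrunc_fun a) (wtrunc_fun b) = wtrunc_fun (a * b).
Proof. by apply: wtrunc_mul; rewrite wextK. Qed.

Lemma wnaddA : associative wnadd.
Proof. by move=> a b c; rewrite -(wextK a) -(wextK b) -(wextK c) !wnaddE addrA. Qed.
Lemma wnaddC : commutative wnadd.
Proof. by move=> a b; rewrite -(wextK a) -(wextK b) !wnaddE addrC. Qed.
Lemma wnadd0 : left_id (wtrunc_fun 0) wnadd.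
Proof. by move=> a; rewrite -(wextK a) !wnaddE add0r. Qed.
Lemma wnaddN : left_inverse (wtrunc_fun 0) wnopp wnadd.
Proof. by move=> a; rewrite -(wextK a) wnoppE !wnaddE addNr. Qed.
Lemma wnmulA : associative wnmul.
Proof. by move=> a b c; rewrite -(wextK a) -(wextK b) -(wextK c) !wnmulE mulrA. Qed.
Lemma wnmulC : commutative wnmul.
Proof. by move=> a b; rewrite -(wextK a) -(wextK b) !wnmulE mulrC. Qed.
Lemma wnmul1 : left_id (wtrunc_fun 1) wnmul.
Proof. by move=> a; rewrite -(wextK a) !wnmulE mul1r. Qed.
Lemma wnmulDl : left_distributive wnmul wnadd.
Proof.
by move=> a b c; rewrite -(wextK a) -(wextK b) -(wextK c) !(wnaddE, wnmulE) mulrDl.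
Qed.

HB.instance Definition _ := GRing.isZmodule.Build (Wn B) wnaddA wnaddC wnadd0 wnaddN.
HB.instance Definition _ := GRing.Zmodule_isComPzRing.Build (Wn B) wnmulA wnmulC wnmul1 wnmulDl.

Lemma wtrunc_zmod : zmod_morphism (@wtrunc_fun B).
Proof. by move=> a b; rewrite -wnaddE -wnoppE. Qed.
Lemma wtrunc_monoid : monoid_morphism (@wtrunc_fun B).
Proof. by split=> // a b; rewrite -wnmulE. Qed.
Definition wtrunc : {rmorphism W B -> Wn B} := HB.pack (@wtrunc_fun B)
  (GRing.isZmodMorphism.Build _ _ _ wtrunc_zmod)
  (GRing.isMonoidMorphism.Build _ _ _ wtrunc_monoid).

Lemma wtruncE (a : W B) i : wtrunc a i = a i. Proof. by []. Qed.
Lemma wtrunc_surj (a : Wn B) : exists b, wtrunc b = a.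
Proof. by exists (wext a); apply: wextK. Qed.
End Ops.

Section Map.
Variables (A B : comPzRingType) (f : {rmorphism A -> B}).
Definition wnmap_fun (a : Wn A) : Wn B := WittN p_pr (f \o a).
Lemma wnmap_trunc (a : W A) : wnmap_fun (wtrunc A a) = wtrunc B (wmap p_pr f a).
Proof. by []. Qed.
Lemma wnmap_zmod : zmod_morphism wnmap_fun.
Proof.
move=> a b; have [x <-] := wtrunc_surj a; have [y <-] := wtrunc_surj b.
by rewrite -rmorphB !wnmap_trunc -!rmorphB.
Qed.
Lemma wnmap_monoid : monoid_morphism wnmap_fun.
Proof.
split=> [|a b].
  by rewrite -(rmorph1 (wtrunc A)) wnmap_trunc !rmorph1.
have [x <-] := wtrunc_surj a; have [y <-] := wtrunc_surj b.
by rewrite -rmorphM !wnmap_trunc -!rmorphM.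
Qed.
Definition wnmap : {rmorphism Wn A -> Wn B} := HB.pack wnmap_fun
  (GRing.isZmodMorphism.Build _ _ _ wnmap_zmod)
  (GRing.isMonoidMorphism.Build _ _ _ wnmap_monoid).
End Map.
End Truncated.

Section Restriction.
Variables (p : nat) (p_pr : prime p) (n : nat) (B : comPzRingType).
Local Notation W := (witt p_pr).
Local Notation Wn := (wittn p_pr).

Definition wres_fun (a : Wn n.+1 B) : Wn n B :=
  WittN p_pr (fun i => a (widen_ord (leqnSn n.+1) i)).
Lemma wres_trunc (a : W B) : wres_fun (wtrunc p_pr n.+1 B a) = wtrunc p_pr n B a.
Proof. by []. Qed.
Lemma wres_zmod : zmod_morphism wres_fun.
Proof.
move=> a b; have [x <-] := wtrunc_surj a; have [y <-] := wtrunc_surj b.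
by rewrite -rmorphB !wres_trunc -!rmorphB.
Qed.
Lemma wres_monoid : monoid_morphism wres_fun.
Proof.
split=> [|a b].
  by rewrite -(rmorph1 (wtrunc p_pr n.+1 B)) wres_trunc !rmorph1.
have [x <-] := wtrunc_surj a; have [y <-] := wtrunc_surj b.
by rewrite -rmorphM !wres_trunc -!rmorphM.
Qed.
Definition wres : {rmorphism Wn n.+1 B -> Wn n B} := HB.pack wres_fun
  (GRing.isZmodMorphism.Build _ _ _ wres_zmod)
  (GRing.isMonoidMorphism.Build _ _ _ wres_monoid).
End Restriction.

Lemma rmorph_ext (A B : comPzRingType) (f g : {rmorphism A -> B}) : f =1 g -> f = g.
Proof.
case: f g => f [[f1] [f2]] [g [[g1] [g2]]] /= /funext E.
move: f1 f2; rewrite E => f1 f2.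
by rewrite (Prop_irrelevance f1 g1) (Prop_irrelevance f2 g2).
Qed.

Section Functors.
Variable R : comPzRingType.

(* Commutative R-algebras. *)
Record alg := Alg {
  alg_ring :> comPzRingType;
  alg_map : {rmorphism R -> alg_ring} }.

Record algHom (A B : alg) := AlgHom {
  hom_map :> {rmorphism A -> B};
  hom_comm : forall r, hom_map (alg_map A r) = alg_map B r }.

Lemma algHom_ext (A B : alg) (f g : algHom A B) : f =1 g -> f = g.
Proof.
case: f g => f fP [g gP] /= /rmorph_ext E.
by move: fP gP; rewrite E => fP gP; congr AlgHom; apply: Prop_irrelevance.
Qed.

Program Definition hom_id (A : alg) : algHom A A := @AlgHom A A idfun _.
Program Definition hom_comp (A B C : alg) (g : algHom B C) (f : algHom A B) :
  algHom A C := @AlgHom A C (g \o f) _.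
Next Obligation. by rewrite /= !hom_comm. Qed.

(* Functors of points: set-valued functors on commutative R-algebras.           *)
Record algFunctor := AlgFunctor {
  pt :> alg -> Type;
  pt_map : forall A B : alg, algHom A B -> pt A -> pt B;
  pt_map_id : forall A x, pt_map (hom_id A) x = x;
  pt_map_comp : forall A B C (g : algHom B C) (f : algHom A B) x,
    pt_map (hom_comp g f) x = pt_map g (pt_map f x) }.

Record natTrans (X Y : algFunctor) := NatTrans {
  nt :> forall A, X A -> Y A;
  nt_natural : forall A B (f : algHom A B) x, nt (pt_map f x) = pt_map f (nt x) }.

Definition isomorphic (X Y : algFunctor) : Prop :=
  exists u : natTrans X Y, forall A, bijective (u A).

Program Definition Spec (A : alg) : algFunctor :=
  @AlgFunctor (algHom A) (fun B C f => hom_comp f) _ _.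
Next Obligation. by apply: algHom_ext. Qed.
Next Obligation. by apply: algHom_ext. Qed.

Definition affine (X : algFunctor) : Prop := exists A : alg, isomorphic (Spec A) X.

Section Subfunctors.
Variable X : algFunctor.

Record subfunctor := Subfunctor {
  sub_mem :> forall A, X A -> Prop;
  sub_stable : forall A B (f : algHom A B) x, sub_mem x -> sub_mem (pt_map f x) }.

Program Definition subfunctor_functor (U : subfunctor) : algFunctor :=
  @AlgFunctor (fun A => {x : X A | U A x})
    (fun A B f x => exist _ (pt_map f (sval x)) (sub_stable f (svalP x))) _ _.
Next Obligation. by apply: eq_exist => /=; rewrite pt_map_id. Qed.
Next Obligation. by apply: eq_exist => /=; rewrite pt_map_comp. Qed.

Definition unit_ideal (A : comPzRingType) (S : A -> Prop) : Prop :=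
  exists n (c s : 'I_n -> A), (forall i, S (s i)) /\ \sum_i c i * s i = 1.

(* Over Spec A, the subfunctor U becomes the open complement of V(S).           *)
Definition open_subfunctor (U : subfunctor) : Prop :=
  forall A (x : X A), exists S : A -> Prop, forall B (f : algHom A B),
    U B (pt_map f x) <-> unit_ideal (fun b => exists2 a, S a & f a = b).

Definition covering (T : Type) (U : T -> subfunctor) : Prop :=
  forall (K : fieldType) (f : {rmorphism R -> K}) (x : X (Alg f)),
  exists t, U t (Alg f) x.

End Subfunctors.

(* u exhibits B as A[1/s]. *)
Definition localization_at (A B : comPzRingType) (s : A) (u : {rmorphism A -> B}) : Prop :=
  [/\ exists t, u s * t = 1,
      forall b, exists a n, b * u s ^+ n = u a
    & forall a, u a = 0 -> exists n, s ^+ n * a = 0].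

(* Sheaf condition for the covers of Spec A by finitely many D(s_i); C i j is     *)
(* the ring of D(s_i s_j).                                                       *)
Definition zariski_local (X : algFunctor) : Prop :=
  forall (A : alg) (n : nat) (s : 'I_n -> A)
    (B : 'I_n -> alg) (u : forall i, algHom A (B i))
    (C : 'I_n -> 'I_n -> alg)
    (v : forall i j, algHom (B i) (C i j)) (w : forall i j, algHom (B j) (C i j)),
  (exists c : 'I_n -> A, \sum_i c i * s i = 1) ->
  (forall i, localization_at (s i) (u i)) ->
  (forall i j, localization_at (s i * s j) (hom_comp (v i j) (u i))) ->
  (forall i j, hom_comp (v i j) (u i) = hom_comp (w i j) (u j)) ->
  forall x : (forall i, X (B i)),
  (forall i j, pt_map (v i j) (x i) = pt_map (w i j) (x j)) ->
  exists! y : X A, forall i, pt_map (u i) y = x i.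

(* Schemes over R, identified with their functors of points (Demazure-Gabriel):  *)
(* Zariski sheaves with a cover by affine open subfunctors.                       *)
Definition is_scheme (X : algFunctor) : Prop :=
  zariski_local X /\
  exists (T : Type) (U : T -> subfunctor X),
    covering U /\
    forall t, open_subfunctor (U t) /\ affine (subfunctor_functor (U t)).

Section Limit.
Variables (F : nat -> algFunctor) (r : forall n, natTrans (F n.+1) (F n)).
Definition compatible (A : alg) (x : forall n, F n A) : Prop :=
  forall n, r n A (x n.+1) = x n.
Lemma compatible_map (A B : alg) (f : algHom A B) (x : forall n, F n A) :
  compatible x -> compatible (fun n => pt_map f (x n)).
Proof. by move=> xP n; rewrite nt_natural xP. Qed.

Program Definition limit : algFunctor :=
  @AlgFunctor (fun A => {x : forall n, F n A | compatible x})
    (fun A B f x => exist _ (fun n => pt_map f (sval x n)) (compatible_map f (svalP x))) _ _.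
Next Obligation.
by apply: eq_exist; apply: functional_extensionality_dep => n /=; rewrite pt_map_id.
Qed.
Next Obligation.
by apply: eq_exist; apply: functional_extensionality_dep => n /=; rewrite pt_map_comp.
Qed.
End Limit.

Section Completion.
Variable p : nat.

(* The p-adic formal completion is the union over m of the closed subfunctors     *)
(* X x Spec Z/p^m, which have the points of X on the algebras where p^m = 0, and   *)
(* none elsewhere.                                                               *)
Definition p_nilpotent (A : comPzRingType) : Prop := exists m, (p ^ m)%:R = 0 :> A.

Lemma p_nilpotent_hom (A B : alg) : algHom A B -> p_nilpotent A -> p_nilpotent B.
Proof. by move=> f [m m0]; exists m; rewrite -(rmorph_nat f) m0 rmorph0. Qed.

Program Definition completion (X : algFunctor) : algFunctor :=
  @AlgFunctor (fun A => {x : X A | p_nilpotent A})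
    (fun A B f x => exist _ (pt_map f (sval x)) (p_nilpotent_hom f (svalP x))) _ _.
Next Obligation. by apply: eq_exist => /=; rewrite pt_map_id. Qed.
Next Obligation. by apply: eq_exist => /=; rewrite pt_map_comp. Qed.

Program Definition completion_map (X Y : algFunctor) (u : natTrans X Y) :
  natTrans (completion X) (completion Y) :=
  @NatTrans (completion X) (completion Y)
    (fun A x => exist _ (u A (sval x)) (svalP x)) _.
Next Obligation. by apply: eq_exist => /=; rewrite nt_natural. Qed.
End Completion.

End Functors.

Section BaseChange.
Variables (R S : comPzRingType) (f : {rmorphism R -> S}).
(* For an S-algebra A, the A-points of X x_R S are the R-morphisms Spec A -> X.  *)
Definition restr (A : alg S) : alg R := @Alg R A (alg_map A \o f).
Program Definition restr_hom (A B : alg S) (g : algHom A B) :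
  algHom (restr A) (restr B) := @AlgHom R (restr A) (restr B) g _.
Next Obligation. by rewrite /= hom_comm. Qed.
Program Definition base_change (X : algFunctor R) : algFunctor S :=
  @AlgFunctor S (fun A => X (restr A)) (fun A B g => pt_map (restr_hom g)) _ _.
Next Obligation.
by rewrite -[RHS]pt_map_id; congr pt_map; apply: algHom_ext.
Qed.
Next Obligation.
by rewrite -pt_map_comp; congr pt_map; apply: algHom_ext.
Qed.
End BaseChange.

Section Residue.
Variables (p : nat) (p_pr : prime p) (B : comPzRingType).
Lemma wghost0 (a : witt p_pr B) : wghost 0 a = a 0%N.
Proof. by rewrite /wghost /ghost big_ord1 subnn expn0 expr1. Qed.
Lemma wresidue_zmod : zmod_morphism (fun a : witt p_pr B => a 0%N).
Proof. by move=> a b; rewrite -(wghost0 (a - b)) rmorphB /= !wghost0. Qed.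
Lemma wresidue_monoid : monoid_morphism (fun a : witt p_pr B => a 0%N).
Proof.
split=> [|a b]; first by rewrite -(wghost0 1) rmorph1.
by rewrite -(wghost0 (a * b)) rmorphM /= !wghost0.
Qed.
Definition wresidue : {rmorphism witt p_pr B -> B} :=
  HB.pack (fun a : witt p_pr B => a 0%N)
  (GRing.isZmodMorphism.Build _ _ _ wresidue_zmod)
  (GRing.isMonoidMorphism.Build _ _ _ wresidue_monoid).
End Residue.

Section WnBaseChange.
Variables (p : nat) (p_pr : prime p) (n : nat) (k : comPzRingType).
Local Notation Wn := (wittn p_pr n).
Definition wn_alg (B : alg k) : alg (Wn k) := @Alg (Wn k) (Wn B) (wnmap p_pr n (alg_map B)).
Program Definition wn_alg_hom (A B : alg k) (f : algHom A B) :
  algHom (wn_alg A) (wn_alg B) := @AlgHom _ (wn_alg A) (wn_alg B) (wnmap p_pr n f) _.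
Next Obligation. by apply: wittnP => i /=; rewrite hom_comm. Qed.

(* On affine schemes Spec B, W_n^*(Spec B) = Spec W_n(B), so the B-points of the   *)
(* Greenberg realization of Z are the W_n(B)-points of Z.                         *)
Program Definition greenberg_realization (Z : algFunctor (Wn k)) : algFunctor k :=
  @AlgFunctor k (fun B => Z (wn_alg B)) (fun A B f => pt_map (wn_alg_hom f)) _ _.
Next Obligation.
by rewrite -[RHS]pt_map_id; congr pt_map; apply: algHom_ext => a; apply: wittnP.
Qed.
Next Obligation.
by rewrite -pt_map_comp; congr pt_map; apply: algHom_ext => a; apply: wittnP.
Qed.
End WnBaseChange.

Section Greenberg.
Variables (p : nat) (p_pr : prime p) (k : comPzRingType).
Variable X : algFunctor (witt p_pr k).

Definition greenberg (n : nat) : algFunctor k := greenberg_realization (base_change (wtrunc p_pr n k) X).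

Program Definition greenberg_res_hom n (B : alg k) :
  algHom (restr (wtrunc p_pr n.+1 k) (wn_alg p_pr n.+1 B))
         (restr (wtrunc p_pr n k) (wn_alg p_pr n B)) :=
  @AlgHom _ (restr (wtrunc p_pr n.+1 k) (wn_alg p_pr n.+1 B))
         (restr (wtrunc p_pr n k) (wn_alg p_pr n B)) (wres p_pr n B) _.

Program Definition greenberg_res n : natTrans (greenberg n.+1) (greenberg n) :=
  @NatTrans k (greenberg n.+1) (greenberg n) (fun B => @pt_map _ X _ _ (greenberg_res_hom n B)) _.
Next Obligation.
by rewrite /= -!pt_map_comp; congr pt_map; apply: algHom_ext => a; apply: wittnP.
Qed.

Definition greenberg_inf : algFunctor k := limit greenberg_res.

(* W(k) -> W(W(k)) -> W(B) -> W_n(B); the structure map of W_n(B) for the jet space. *)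
Definition jet_map n (B : alg (witt p_pr k)) : {rmorphism witt p_pr k -> wittn p_pr n B} :=
  wtrunc p_pr n B \o (wmap p_pr (alg_map B) \o wdelta p_pr k).
Definition jet_alg n (B : alg (witt p_pr k)) : alg (witt p_pr k) :=
  @Alg (witt p_pr k) (wittn p_pr n B) (jet_map n B).
Program Definition jet_alg_hom n (A B : alg (witt p_pr k)) (f : algHom A B) :
  algHom (jet_alg n A) (jet_alg n B) :=
  @AlgHom _ (jet_alg n A) (jet_alg n B) (wnmap p_pr n f) _.
Next Obligation. by apply: wittnP => i /=; rewrite hom_comm. Qed.

Program Definition jet_space (n : nat) : algFunctor (witt p_pr k) :=
  @AlgFunctor _ (fun B => X (jet_alg n B)) (fun A B f => pt_map (jet_alg_hom n f)) _ _.
Next Obligation.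
by rewrite -[RHS]pt_map_id; congr pt_map; apply: algHom_ext => a; apply: wittnP.
Qed.
Next Obligation.
by rewrite -pt_map_comp; congr pt_map; apply: algHom_ext => a; apply: wittnP.
Qed.

Program Definition jet_res_hom n (B : alg (witt p_pr k)) :
  algHom (jet_alg n.+1 B) (jet_alg n B) :=
  @AlgHom _ (jet_alg n.+1 B) (jet_alg n B) (wres p_pr n B) _.

Program Definition jet_space_res n : natTrans (jet_space n.+1) (jet_space n) :=
  @NatTrans _ (jet_space n.+1) (jet_space n) (fun B => @pt_map _ X _ _ (jet_res_hom n B)) _.
Next Obligation.
by rewrite /= -!pt_map_comp; congr pt_map; apply: algHom_ext => a; apply: wittnP.
Qed.

Definition jet_space_inf := limit jet_space_res.
Definition jet_space_hat (n : nat) : algFunctor (witt p_pr k) := completion p (jet_space n).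
Definition jet_space_hat_res n : natTrans (jet_space_hat n.+1) (jet_space_hat n) :=
  completion_map p (jet_space_res n).
Definition jet_space_hat_inf := limit jet_space_hat_res.
End Greenberg.

Definition special_fiber (p : nat) (p_pr : prime p) (k : comPzRingType)
  (Y : algFunctor (witt p_pr k)) : algFunctor k := base_change (wresidue p_pr k) Y.

(* Main.v *)
Require Import Defs.
From mathcomp Require Import all_boot all_order all_algebra.
From mathcomp.classical Require Import boolp.

(** The [k]-algebra [B] is a [W(k)]-algebra through the residue map, so the jet
    space sees [W_n(B)] with the structure map [W(k) -> W(W(k)) -> W(k) -> W_n(B)],
    whose middle arrow is induced by the residue map. The composite
    [W(k) -> W(W(k)) -> W(k)] has ghost components [w_0 \o F^n = w_n], hence is the
    identity, and the two [W(k)]-algebra structures on [W_n(B)] agree at every level,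
    compatibly with truncation. The completion changes nothing because [p = 0]
    in [B]. *)

Set Implicit Arguments.
Unset Strict Implicit.
Unset Printing Implicit Defensive.

Import GRing.Theory.
Local Open Scope ring_scope.
Local Obligation Tactic := idtac.

Section ResidueOfDelta.
Variables (p : nat) (p_pr : prime p).

Lemma wghost_iter_frob (B : comPzRingType) (a : witt p_pr B) m n :
  wghost m (iter n (frob p_pr B) a) = wghost (m + n) a.
Proof.
by elim: n m => [|n IHn] m; rewrite ?addn0 // iterS wghost_wfrob IHn addSnnS.
Qed.

Lemma wdelta_residue (B : comPzRingType) (a : witt p_pr B) :
  wmap p_pr (wresidue p_pr B) (wdelta p_pr B a) = a.
Proof.
(* Ghost components need not determine a Witt vector over [B], but they do over the torsion-free
   ring [polyZ]; so [a] is lifted to [x] over [polyZ]. *)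
have [f [x [_ [-> _]]]] := witt_lift2 a a.
transitivity (wmap p_pr f (wmap p_pr (wresidue p_pr polyZ) (wdelta p_pr _ x))).
  (* Naturality of [wdelta] in [f]; the residue maps commute with [f] on each coordinate. *)
  rewrite /= -wmap_wdelta_fun; exact: wittP.
congr (wmap p_pr f _); apply: wghostI => n.
by rewrite wghost_wmap wghost_wdelta /= -wghost0 wghost_iter_frob.
Qed.

End ResidueOfDelta.

Lemma isomorphic_trans (R : comPzRingType) (X Y Z : algFunctor R) :
  isomorphic X Y -> isomorphic Y Z -> isomorphic X Z.
Proof.
move=> [u u_bij] [v v_bij].
unshelve eexists (@NatTrans _ _ _ (fun A => v A \o u A) _).
  by move=> A B f x; rewrite /= !nt_natural.
by move=> A; apply: bij_comp.
Qed.

Section CompletionOfFiber.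
Variables (R S : comPzRingType) (f : {rmorphism R -> S}) (p : nat).
Hypothesis S_nilp : p_nilpotent p S.
Variables (F : nat -> algFunctor R) (r : forall n, natTrans (F n.+1) (F n)).

Lemma p_nilpotent_alg (A : alg S) : p_nilpotent p A.
Proof.
by case: S_nilp => m m0; exists m; rewrite -(rmorph_nat (alg_map A)) m0 rmorph0.
Qed.

Program Definition to_completion :
  natTrans (base_change f (limit r))
           (base_change f (limit (fun n => completion_map p (r n)))) :=
  @NatTrans _ (base_change f (limit r))
    (base_change f (limit (fun n => completion_map p (r n))))
    (fun A x => exist _ (fun n => exist _ (sval x n) (p_nilpotent_alg A)) _) _.
Next Obligation. by move=> A [x xP] n; apply: eq_exist; apply: xP. Qed.
Next Obligation.
move=> A B g [x xP]; apply: eq_exist; apply: functional_extensionality_dep => n.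
exact: eq_exist.
Qed.

(** The completion only adds to a point a proof that [p] is nilpotent, which every [S]-algebra
    inherits from [S]; forgetting it inverts [to_completion]. *)
Lemma completion_fiber_isomorphic :
  isomorphic (base_change f (limit r))
             (base_change f (limit (fun n => completion_map p (r n)))).
Proof.
exists to_completion => A.
unshelve eexists.
- move=> [x xP]; exists (fun n => sval (x n)) => n.
  by rewrite -[in RHS](xP n).
- by move=> [x xP]; apply: eq_exist.
- move=> [x xP]; apply: eq_exist; apply: functional_extensionality_dep => n.
  by move=> /=; case: (x n) => y yP; apply: eq_exist.
Qed.

End CompletionOfFiber.

Section GreenbergJet.
Variables (p : nat) (p_pr : prime p) (k : comPzRingType).

Local Notation greenberg_alg n B :=
  (restr (wtrunc p_pr n k) (wn_alg p_pr n B)).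
Local Notation jet_fiber_alg n B := (jet_alg n (restr (wresidue p_pr k) B)).

Lemma jet_map_residue n (B : alg k) a :
  jet_map n (restr (wresidue p_pr k) B) a =
  wnmap p_pr n (alg_map B) (wtrunc p_pr n k a).
(* Once the right-hand [a] is expanded as the coordinatewise residue of its [wdelta], both sides
   have the same coordinates. *)
Proof. by rewrite -{2}[a]wdelta_residue; apply: wittnP. Qed.

(** The two structure maps on the ring $W_n(B)$ are provably equal but not convertible; an algebra
    morphism over the identity avoids transporting points along an equality of algebras. *)
Program Definition greenberg_jet_hom n (B : alg k) :
  algHom (greenberg_alg n B) (jet_fiber_alg n B) :=
  @AlgHom _ (greenberg_alg n B) (jet_fiber_alg n B) idfun _.
Next Obligation. by move=> n B a; rewrite [RHS]jet_map_residue. Qed.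

Program Definition jet_greenberg_hom n (B : alg k) :
  algHom (jet_fiber_alg n B) (greenberg_alg n B) :=
  @AlgHom _ (jet_fiber_alg n B) (greenberg_alg n B) idfun _.
Next Obligation. by move=> n B a; rewrite [LHS]jet_map_residue. Qed.

Variable X : algFunctor (witt p_pr k).

Program Definition greenberg_to_jet :
  natTrans (greenberg_inf X) (special_fiber (jet_space_inf X)) :=
  @NatTrans _ (greenberg_inf X) (special_fiber (jet_space_inf X))
    (fun B x => exist _ (fun n => pt_map (greenberg_jet_hom n B) (sval x n)) _) _.
Next Obligation.
move=> B [x xP] n /=; rewrite -(xP n) /= -!pt_map_comp.
(* Both composites have the restriction [wres] as underlying ring map. *)
by congr pt_map; apply: algHom_ext.
Qed.
Next Obligation.
move=> A B f [x xP]; apply: eq_exist; apply: functional_extensionality_dep => n /=.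
by rewrite -!pt_map_comp; congr pt_map; apply: algHom_ext.
Qed.

Lemma greenberg_jet_isomorphic :
  isomorphic (greenberg_inf X) (special_fiber (jet_space_inf X)).
Proof.
exists greenberg_to_jet => B.
unshelve eexists.
- move=> [x xP]; exists (fun n => pt_map (jet_greenberg_hom n B) (x n)) => n.
  rewrite -(xP n) /= -!pt_map_comp.
  by congr pt_map; apply: algHom_ext.
- move=> [x xP]; apply: eq_exist; apply: functional_extensionality_dep => n /=.
  by rewrite -pt_map_comp -[RHS](@pt_map_id _ X); congr pt_map; apply: algHom_ext.
- move=> [x xP]; apply: eq_exist; apply: functional_extensionality_dep => n /=.
  by rewrite -pt_map_comp -[RHS](@pt_map_id _ X); congr pt_map; apply: algHom_ext.
Qed.

End GreenbergJet.

Theorem corollary4p11 (p : nat) (p_pr : prime p) (k : fieldType)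
  (k_char : p \in [pchar k])
  (k_perfect : forall x : k, exists y : k, y ^+ p = x)
  (X : algFunctor (witt p_pr k)) (X_scheme : is_scheme X) :
  isomorphic (greenberg_inf X) (special_fiber (jet_space_inf X)) /\
  isomorphic (greenberg_inf X) (special_fiber (jet_space_hat_inf X)).
Proof.
split; first exact: greenberg_jet_isomorphic.
apply: isomorphic_trans (greenberg_jet_isomorphic X) _.
apply: completion_fiber_isomorphic.
by exists 1; rewrite expn1 pcharf0.
Qed.
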